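(* Let $G$ be an infinite non-abelian $\mathfrak{C}'$-cofinite group. Then $Z(G)=L(G)=F(G)$. In particular, $G$ is not an Engel group.
   Context: For a group $G$, $\mathfrak{C}'_G$ is the topology on $G$ having as a subbase of its closed sets all singletons together with all cosets $hC_G(g)$, $g,h\in G$, where $C_G(g)$ is the centralizer of $g$ in $G$. $G$ is $\mathfrak{C}'$-cofinite if $\mathfrak{C}'_G$ is the cofinite topology on $G$ (closed sets: $G$ and the finite subsets of $G$). $Z(G)$ is the center of $G$. For $g,h\in G$ put $[g,h]=ghg^{-1}h^{-1}$, and define inductively $[x,_0 y]=x$ and $[x,_{n+1}y]=[[x,_n y],y]$. Put $L(G)=\{x\in G: \text{for every } g\in G \text{ there exists } n\in\mathbb{N} \text{ such that } [x,_n g]=e\}$, where $e$ is the neutral element. $G$ is an Engel group if $G=L(G)$. The Fitting subgroup $F(G)$ is the subgroup of $G$ generated by all nilpotent normal subgroups of $G$. *)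

(* Defs.v *)
From HB Require Import structures.
From mathcomp Require Import all_boot.
From mathcomp Require Import all_classical topology_structure.

Set Implicit Arguments.
Unset Strict Implicit.
Unset Printing Implicit Defensive.

Local Open Scope classical_set_scope.
Local Open Scope group_scope.

Section Groups.
Variable G : groupType.
Implicit Types (A B H : set G) (g h x y : G).

Definition abelian_group : Prop := forall x y, commute x y.

Definition centralizer g : set G := [set x | commute x g].

Definition center : set G := [set x | forall g, commute x g].

Definition left_coset h A : set G := [set h * x | x in A].

Definition subgroup H : Prop := group_closed [in H].

Definition normal_subgroup H : Prop :=
  subgroup H /\ forall x g, H x -> H (x ^ g).

Definition generated A : set G := smallest subgroup A.

(* The library's [~ g, h] is g^-1 h^-1 g h; here [g, h] = g h g^-1 h^-1. *)
Definition comm g h : G := g * h * g^-1 * h^-1.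

Definition comm_subgroup A B : set G :=
  generated [set comm x y | x in A & y in B].

Fixpoint lower_central_series H (n : nat) : set G :=
  if n is m.+1 then comm_subgroup (lower_central_series H m) H else H.

Definition nilpotent_subgroup H : Prop :=
  subgroup H /\ exists n, lower_central_series H n = [set 1].

Definition fitting : set G :=
  generated (\bigcup_(H in [set H | normal_subgroup H /\ nilpotent_subgroup H]) H).

Definition iter_comm x (n : nat) y : G := iter n (fun z => comm z y) x.

Definition left_engel_set : set G :=
  [set x | forall g, exists n, iter_comm x n g = 1].

Definition engel_group : Prop := [set: G] = left_engel_set.

Definition Cprime_closed_subbase : set (set G) :=
  [set A | (exists x, A = [set x]) \/
           (exists h g, A = left_coset h (centralizer g))].

End Groups.

Arguments abelian_group : clear implicits.
Arguments center : clear implicits.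
Arguments fitting : clear implicits.
Arguments left_engel_set : clear implicits.
Arguments engel_group : clear implicits.
Arguments Cprime_closed_subbase : clear implicits.

(* The carrier of G with the topology C'_G: the complements of the members of
   the closed subbase form a subbase of open sets. *)
Definition Cprime_space (G : groupType) : Type := G.

HB.instance Definition _ (G : groupType) := Choice.copy (Cprime_space G) G.

HB.instance Definition _ (G : groupType) :=
  isSubBaseTopological.Build (Cprime_space G)
    [set U : set G | Cprime_closed_subbase G (~` U)] id.

Definition cofinite_space (T : topologicalType) : Prop :=
  forall A : set T, closed A <-> A = [set: T] \/ finite_set A.

Definition Cprime_cofinite (G : groupType) : Prop :=
  cofinite_space (Cprime_space G).

(* Main.v *)
Require Import Defs.
From mathcomp Require Import all_boot all_classical.
From mathcomp Require Import finmap topology_structure.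

(** The topology enters only through centralizers: a coset of C(g) is closed,
    hence finite or all of G, so C(g) is finite for every noncentral g.  As G is
    not abelian, Z(G) lies in such a centralizer and is finite too.

    Say that a is an Engel operator when every g satisfies [g,_n a] = 1 for
    some n.  Both L(G) and the normal nilpotent subgroups consist of Engel
    operators: the former by Heineken's identity
    [g,_(n+1) x] = g [x,_n x^g] g^-1, where n > 0 and x^g = g^-1 x g, the latter
    because [g,_(n+1) x] lies in the n-th term of the lower central series.  So
    everything follows from [engel_operator_central]: an Engel operator of an
    infinite group with finite center and finite noncentral centralizers is
    central.  Conversely a central element is clearly in L(G), and Z(G) is itself
    a nilpotent normal subgroup.

    Let X be the set of noncentral Engel operators; it is invariant under
    conjugation, so if it contains x, it contains the conjugacy class of x, which
    is infinite because C(x) is finite.  On the other hand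
    [finite_engel_blocks] shows that X is finite, as follows.
    A hypercentral subgroup M that contains a noncentral y has an element z
    outside Z(G) with [z, M] inside Z(G).  There are finitely many z with [z, y]
    in Z(G), and each of them commutes with finitely many elements modulo Z(G),
    so M lies in a finite set that depends on y alone.  Consequently every y in X
    lies in a maximal member of the family of hypercentral subgroups generated
    by elements of X, and if X is infinite there are two different maximal ones.
    Take such a pair M, M' for which D = X & M & M' is inclusion-maximal; the
    same finite sets show that it exists.  Then [engel_block_zipper], in the
    style of the proofs of Baer's theorem on Engel elements and of the
    Baer-Suzuki theorem, produces a conjugate of M different from M that meets M
    in more elements of X, a contradiction. *)

Set Implicit Arguments.
Unset Strict Implicit.
Unset Printing Implicit Defensive.

Local Open Scope classical_set_scope.
Local Open Scope group_scope.

(** * Finite sets *)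

Section FiniteSets.

Lemma finite_preimage_fibers (T U : Type) (f : T -> U) (B : set U) :
  finite_set B -> (forall b, B b -> finite_set (f @^-1` [set b])) ->
  finite_set (f @^-1` B).
Proof.
move=> Bfin ffin.
apply: (@sub_finite_set _ _ (\bigcup_(b in B) f @^-1` [set b])).
  by move=> t Bt; exists (f t).
exact: bigcup_finite.
Qed.

(** Finiteness of one common upper bound replaces Zorn's lemma: enlarging A
    shrinks the complement of A in B. *)
Lemma exists_maximal_set (T : choiceType) (P : set (set T)) (A B : set T) :
  finite_set B -> P A -> (forall C, P C -> A `<=` C -> C `<=` B) ->
  exists C, [/\ P C, A `<=` C & forall E, P E -> C `<=` E -> E `<=` C].
Proof.
move=> Bfin.
have [n] := ubnP #|` fset_set (B `\` A)|.
elim: n => // n IHn in A * => An PA AB.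
have [Amax|/existsNP [E /not_implyP [PE /not_implyP [AE EA]]]] :=
    pselect (forall E, P E -> A `<=` E -> E `<=` A).
  by exists A; split.
have [|//|C PC EC|C [PC EC Cmax]] := IHn E.
- rewrite -ltnS; apply: leq_trans An; rewrite ltnS.
  apply: fproper_ltn_card.
  rewrite fproperEneq.
  apply/andP; split; last first.
    by rewrite -fset_set_sub; try exact: finite_setD; move=> x [Bx Ex]; split=> // /AE.
  apply/eqP => /(congr1 (fun s => [set` s])).
  rewrite !fset_setK; try exact: finite_setD.
  move=> eqBEA; apply: EA => x Ex; apply: contrapT => Ax.
  have : (B `\` A) x by split=> //; exact: AB PE AE _ Ex.
  by rewrite -eqBEA => -[].
- by apply: AB => //; exact: subset_trans EC.
- by exists C; split=> //; exact: subset_trans EC.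
Qed.

End FiniteSets.

(** * Conjugates, normalizers and commutators *)

Section Conjugation.
Variable G : groupType.
Implicit Types (x y z g h a : G) (M N D : set G).

Lemma subgroupP M :
  subgroup M <-> M 1 /\ (forall x y, M x -> M y -> M (x / y)).
Proof.
split=> -[M1 MD]; split.
- exact: set_mem M1.
- by move=> x y /mem_set Mx /mem_set My; exact: set_mem (MD _ _ Mx My).
- exact: mem_set.
- by move=> x y /set_mem Mx /set_mem My; apply: mem_set; exact: MD.
Qed.

Lemma subgroup_one M : subgroup M -> M 1.
Proof. by case/subgroupP. Qed.

Lemma subgroup_inv M x : subgroup M -> M x -> M x^-1.
Proof. by case/subgroupP=> M1 MD Mx; rewrite -div1g; exact: MD. Qed.

Lemma subgroup_mul M x y : subgroup M -> M x -> M y -> M (x * y).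
Proof.
move=> sgM Mx My; rewrite -[y]invgK.
by case/subgroupP: (sgM) => _; apply=> //; exact: subgroup_inv.
Qed.

Lemma subgroup_generated M : subgroup (generated M).
Proof.
apply/subgroupP; split=> [N [sgN _]|x y Mx My N N_M].
  exact: subgroup_one.
by case: (N_M) => /subgroupP[_ ND] _; apply: ND; [exact: Mx|exact: My].
Qed.

(** The conjugate g M g^-1. *)
Definition conj_set M g : set G := [set y | M (y ^ g)].

Definition normalizer M : set G := [set g | conj_set M g = M].

Lemma conj_setM M g h : conj_set M (g * h) = conj_set (conj_set M h) g.
Proof. by apply/funext => y; rewrite /conj_set /= conjgM. Qed.

Lemma conj_set1 M : conj_set M 1 = M.
Proof. by apply/funext => y; rewrite /conj_set /= conjg1. Qed.

Lemma conj_setK M g : conj_set (conj_set M g) g^-1 = M.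
Proof. by rewrite -conj_setM mulVg conj_set1. Qed.

Lemma conj_setKV M g : conj_set (conj_set M g^-1) g = M.
Proof. by rewrite -conj_setM mulgV conj_set1. Qed.

Lemma conj_setS M N g : M `<=` N -> conj_set M g `<=` conj_set N g.
Proof. by move=> MN y /MN. Qed.

Lemma subgroup_normalizer M : subgroup (normalizer M).
Proof.
apply/subgroupP; split=> [|g h Mg Mh]; first exact: conj_set1.
by rewrite /normalizer /= conj_setM -{1}Mh conj_setK.
Qed.

Lemma normalizerJ M g x : normalizer M g -> M x -> M (x ^ g).
Proof. by move=> Mg; rewrite -{1}Mg. Qed.

Lemma normalizerJV M g x : normalizer M g -> M x -> M (x ^ g^-1).
Proof. by move=> /(subgroup_inv (subgroup_normalizer M)); exact: normalizerJ. Qed.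

Lemma normalizerP M g :
  (forall x, M x -> M (x ^ g)) -> (forall x, M x -> M (x ^ g^-1)) ->
  normalizer M g.
Proof.
move=> Mg MVg; apply/seteqP; split=> x; last exact: Mg.
by move/MVg; rewrite conjgK.
Qed.

Lemma subgroup_conj M g : subgroup M -> subgroup (conj_set M g).
Proof.
move=> /subgroupP[M1 MD]; apply/subgroupP; split=> [|x y Mx My].
  by rewrite /conj_set /= conj1g.
by rewrite /conj_set /= conjMg conjVg; exact: MD.
Qed.

Lemma subgroup_sub_normalizer M : subgroup M -> M `<=` normalizer M.
Proof.
move=> sgM g Mg; have MVg := subgroup_inv sgM Mg.
by apply: normalizerP => x Mx; rewrite conjgE ?invgK;
  do !apply: subgroup_mul => //.
Qed.

Lemma commE g h : comm g h = h ^ g^-1 / h.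
Proof. by rewrite /comm conjgE invgK !mulgA. Qed.

Lemma commV g h : (comm g h)^-1 = comm h g.
Proof. by rewrite /comm !gnorm. Qed.

Lemma commJ x y g : comm x y ^ g = comm (x ^ g) (y ^ g).
Proof. by rewrite /comm !conjMg !conjVg. Qed.

Lemma comm1g g : comm 1 g = 1.
Proof. by rewrite /comm !gnorm. Qed.

Lemma commgg g : comm g g = 1.
Proof. by rewrite /comm !gnorm. Qed.

Lemma comm_eq1 g h : comm g h = 1 <-> commute g h.
Proof.
rewrite /comm /commute; split=> [gh1|->]; last by rewrite !gnorm.
by rewrite -[RHS]mul1g -gh1 !gnorm.
Qed.

Lemma subgroup_comm M x y : subgroup M -> M x -> M y -> M (comm x y).
Proof.
move=> sgM Mx My; rewrite /comm.
by do ![apply: subgroup_mul => //|apply: subgroup_inv => //].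
Qed.

(** The centralizer of z modulo N, when N is not assumed normal in a larger
    group. Its being a subgroup reduces statements about all of a generated
    subgroup to statements about the generators. *)
Lemma subgroup_centralizer_mod N z :
  subgroup N -> subgroup [set k | normalizer N k /\ N (comm z k)].
Proof.
move=> sgN; apply/subgroupP; split=> [|k l [Nk zk] [Nl zl]].
  split; first exact: subgroup_one (subgroup_normalizer N).
  by rewrite -commV comm1g invg1; exact: subgroup_one.
have Nkl : normalizer N (l / k).
  by case/subgroupP: (subgroup_normalizer N) => _; exact.
split; first by case/subgroupP: (subgroup_normalizer N) => _; exact.
suff -> : comm z (k / l) = comm z k * (comm z l)^-1 ^ (l / k).
  by apply: subgroup_mul => //; apply: normalizerJ => //; exact: subgroup_inv.
by rewrite /comm conjgE !gnorm.
Qed.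

End Conjugation.

(** * Hypercentral subgroups and Engel operators *)

Section Hypercentral.
Variable G : groupType.
Implicit Types (x y z g h a : G) (M N D K : set G).

(** For finite M this is nilpotency, in the form that every nontrivial quotient
    has a nontrivial center.  Letting N range over all subgroups normalized by M,
    rather than over the normal subgroups of M, changes nothing (replace N by
    its intersection with M) and lets N be the center of G. *)
Definition hypercentral M : Prop :=
  forall N, subgroup N -> M `<=` normalizer N -> ~ M `<=` N ->
  exists z, [/\ M z, ~ N z & forall k, M k -> N (comm z k)].

Lemma hypercentral1 : hypercentral [set 1 : G].
Proof. by move=> N sgN _ []; move=> _ ->; exact: subgroup_one. Qed.

Lemma hypercentral_conj M g : hypercentral M -> hypercentral (conj_set M g).
Proof.
move=> hM N sgN nN MN.
have [k Mk||z [Mz Nz zM]] := hM (conj_set N g^-1) (subgroup_conj _ sgN).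
- have Nk : normalizer N (k ^ g^-1) by apply: nN; rewrite /conj_set /= conjgKV.
  by rewrite /normalizer /= -conj_setM -[in RHS]Nk -conj_setM conjgE !gnorm.
- move=> MNg; apply: MN; rewrite -[N](conj_setKV _ g).
  exact: conj_setS.
- exists (z ^ g^-1); rewrite /conj_set /= conjgKV; split=> // k Mk.
  by rewrite -[k](conjgK g) -commJ; exact: zM.
Qed.

(** The normalizer condition.  A nontrivial central element of M modulo the
    core of K in M cannot lie in K, since all its conjugates would then lie in K;
    and it normalizes K because its commutators fall in the core. *)
Lemma hypercentral_normalizer M K :
  subgroup M -> hypercentral M -> subgroup K -> K `<=` M -> ~ M `<=` K ->
  exists h, [/\ M h, ~ K h & normalizer K h].
Proof.
move=> sgM hM sgK KM MK.
pose N : set G := [set y | forall k, M k -> K (y ^ k)].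
have sgN : subgroup N.
  apply/subgroupP; split=> [k _|x y Nx Ny k Mk].
    by rewrite conj1g; exact: subgroup_one.
  rewrite conjMg conjVg; apply: subgroup_mul => //; first exact: Nx.
  by apply: subgroup_inv => //; exact: Ny.
have nN : M `<=` normalizer N.
  move=> g Mg; apply: normalizerP => x Nx k Mk; rewrite -conjgM; apply: Nx.
    exact: subgroup_mul.
  by apply: subgroup_mul => //; exact: subgroup_inv.
have NK y : N y -> K y by move/(_ 1 (subgroup_one sgM)); rewrite conjg1.
have [|h [Mh Nh hM']] := hM N sgN nN.
  by move=> MN; apply: MK => y /MN /NK.
have NV k : M k -> N (comm h k)^-1.
  by move=> Mk; exact: subgroup_inv sgN (hM' _ Mk).
exists h; split=> //.
  move=> Kh; apply: Nh => k Mk.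
  have -> : h ^ k = (comm h k^-1)^-1 * h.
    by rewrite commV /comm conjgE invgK !gnorm.
  apply: subgroup_mul => //; apply/NK/NV.
  exact: subgroup_inv.
apply: normalizerP => y Ky.
  have -> : y ^ h = (comm h y)^-1 ^ h * y.
    by rewrite commV /comm !conjgE !gnorm.
  apply: subgroup_mul => //.
  exact: NK (normalizerJ (nN _ Mh) (NV _ (KM _ Ky))).
have -> : y ^ h^-1 = comm h y * y by rewrite commE !gnorm.
by apply: subgroup_mul => //; exact: NK (hM' _ (KM _ Ky)).
Qed.

Definition engel_operator a : Prop :=
  forall g, exists n, iter_comm g n a = 1.

Lemma iter_commJ x n y g : iter_comm x n y ^ g = iter_comm (x ^ g) n (y ^ g).
Proof. by elim: n => //= n IHn; rewrite commJ IHn. Qed.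

Lemma engel_operatorJ a g : engel_operator a -> engel_operator (a ^ g).
Proof.
move=> aE h; have [n an1] := aE (h ^ g^-1).
by exists n; rewrite -[h](conjgKV g) -iter_commJ an1 conj1g.
Qed.

(** Heineken's observation: [g, x] is (x ^ g^-1) x^-1, and the factor x^-1
    disappears in the next commutator with x, so that from there on one is
    iterating commutators of a conjugate of x with x. *)
Lemma left_engel_set_operator x : left_engel_set G x -> engel_operator x.
Proof.
move=> xE g; have [n xn1] := xE (x ^ g); exists n.+2.
have comm_divr b : comm (b / x) x = comm b x by rewrite /comm !gnorm.
suff -> : iter_comm g n.+2 x = iter_comm x n.+1 (x ^ g) ^ g^-1.
  by rewrite /iter_comm iterS -/(iter_comm _ _ _) xn1 comm1g conj1g.
by rewrite iter_commJ conjgK /iter_comm !iterSr [comm g x]commE comm_divr.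
Qed.

(** The sequence h, [h, a], [[h, a], a], etc. starts outside N and ends at 1,
    so that some term is the last one outside N. *)
Lemma engel_last_step (V N : set G) a h :
  engel_operator a -> (forall y, V y -> V (comm y a)) -> N 1 -> V h -> ~ N h ->
  exists z, [/\ V z, ~ N z & N (comm z a)].
Proof.
move=> aE VC N1; have [n] := aE h.
elim: n h => [|n IHn] h; first by rewrite /iter_comm /= => -> _ /(_ N1).
rewrite /iter_comm iterSr => hn1 Vh Nh.
have [Nha|Nha] := pselect (N (comm h a)); first by exists h.
by apply: (IHn (comm h a)) => //; exact: VC.
Qed.

(** Modulo N, the elements of M that are central in M form a subgroup on which
    a acts, and the Engel condition makes the action unipotent, so that it has a
    nontrivial fixed point.  If M is trivial modulo N, then a itself is
    central. *)
Lemma hypercentral_adjoin M a :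
  subgroup M -> hypercentral M -> normalizer M a -> engel_operator a ->
  hypercentral (generated (M `|` [set a])).
Proof.
move=> sgM hM Ma aE N sgN; set H := generated _ => nN HN.
have MH : M `<=` H by move=> x Mx; apply: sub_gen_smallest; left.
have Ha : H a by apply: sub_gen_smallest; right.
have central_mod z : (forall k, M k -> N (comm z k)) -> N (comm z a) ->
    forall k, H k -> N (comm z k).
  move=> zM za k; suff : H `<=` [set k | normalizer N k /\ N (comm z k)].
    by move=> /[apply] -[].
  apply: smallest_sub; first exact: subgroup_centralizer_mod.
  move=> y [My|->] /=; last by split=> //; exact: nN.
  by split; [exact: nN (MH _ _)|exact: zM].
have [MN|MN] := pselect (M `<=` N).
  (* The quotient is generated by the image of a. *)
  exists a; split=> //.
    by move=> Na; apply: HN; apply: smallest_sub => // x [/MN|->].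
  apply: central_mod; last by rewrite commgg; exact: subgroup_one.
  move=> k Mk; apply: MN; rewrite commE.
  by case/subgroupP: (sgM) => _; apply=> //; exact: normalizerJV.
have [||h [Mh Nh hN]] := hM N sgN.
- by move=> x /MH; exact: nN.
- by [].
pose V := [set z | M z /\ forall k, M k -> N (comm z k)].
have VC y : V y -> V (comm y a).
  move=> [My yN]; have -> : comm y a = y / y ^ a^-1.
    by rewrite /comm conjgE !gnorm.
  have Mya := normalizerJV Ma My.
  split; first by case/subgroupP: (sgM) => _; exact.
  move=> k Mk; rewrite -commV; apply: subgroup_inv => //.
  have /subgroupP[_] := subgroup_centralizer_mod k sgN.
  move=> /(_ y (y ^ a^-1)) /= yy; apply: (yy _ _).2.
    split; first exact: nN (MH _ _).
    by rewrite -commV; apply: subgroup_inv => //; exact: yN.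
  split; first exact: nN (MH _ _).
  rewrite -commV; apply: subgroup_inv => //.
  rewrite -[k](conjgK a) -commJ; apply: normalizerJV; first exact: nN.
  by apply: yN; exact: normalizerJ.
have [//|z [[Mz zN] Nz za]] := engel_last_step aE VC (subgroup_one sgN) _ Nh.
exists z; split=> //; first exact: MH.
exact: central_mod.
Qed.

End Hypercentral.

(** * Hypercentral subgroups generated by Engel operators *)

Section EngelBlocks.
Variables (G : groupType) (X : set G).
Hypothesis X_conj : forall x g, X x -> X (x ^ g).
Hypothesis X_engel : forall x, X x -> engel_operator x.
Implicit Types (M D : set G).

(** Generation by X makes a block determined by its elements of X: distinct
    maximal blocks M and M' have incomparable intersections with X. *)
Definition engel_block M : Prop :=
  [/\ subgroup M, hypercentral M & M `<=` generated (X `&` M)].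

Definition maximal_block M : Prop :=
  engel_block M /\ forall M', engel_block M' -> M `<=` M' -> M' `<=` M.

Lemma engel_block_conj M g : engel_block M -> engel_block (conj_set M g).
Proof.
move=> [sgM hM genM]; split.
- exact: subgroup_conj.
- exact: hypercentral_conj.
move=> y /genM.
suff /[apply] : generated (X `&` M) `<=`
    conj_set (generated (X `&` conj_set M g)) g^-1.
  by rewrite /conj_set /= conjgK.
apply: smallest_sub; first exact/subgroup_conj/subgroup_generated.
move=> x [Xx Mx]; apply: sub_gen_smallest; split; first exact: X_conj.
by rewrite /conj_set /= conjgKV.
Qed.

Lemma maximal_block_conj M g :
  maximal_block M -> maximal_block (conj_set M g).
Proof.
move=> [bM maxM]; split=> [|M' bM' MM']; first exact: engel_block_conj.
rewrite -[M'](conj_setKV _ g); apply: conj_setS; apply: maxM.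
  exact: engel_block_conj.
by rewrite -[M](conj_setK _ g); exact: conj_setS.
Qed.

Lemma engel_block1 : engel_block [set 1].
Proof.
split; last 1 first.
- by move=> _ ->; exact: subgroup_one (subgroup_generated _).
- by apply/subgroupP; split=> // _ _ -> ->; rewrite divg1.
- exact: hypercentral1.
Qed.

Lemma engel_block_adjoin M a : engel_block M -> X a -> normalizer M a ->
  engel_block (generated (M `|` [set a])).
Proof.
move=> [sgM hM genM] Xa Ma; split.
- exact: subgroup_generated.
- by apply: hypercentral_adjoin => //; exact: X_engel.
apply: smallest_sub; first exact: subgroup_generated.
move=> x [/genM|->]; last first.
  apply: sub_gen_smallest; split=> //.
  by apply: sub_gen_smallest; right.
apply: smallest_sub; first exact: subgroup_generated.
move=> y [Xy My]; apply: sub_gen_smallest; split=> //.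
by apply: sub_gen_smallest; left.
Qed.

(** Otherwise adjoining a to M would give a larger block. *)
Lemma maximal_block_normalizer M a :
  maximal_block M -> X a -> normalizer M a -> M a.
Proof.
move=> [bM maxM] Xa Ma; apply: (maxM _ (engel_block_adjoin bM Xa Ma)).
  by move=> x Mx; apply: sub_gen_smallest; left.
by apply: sub_gen_smallest; right.
Qed.

(** If the normalizer K of D in M had no elements of X outside D, then X & K = D,
    so that everything normalizing K would normalize D, and K would be its own
    normalizer in M; by the normalizer condition K = M. *)
Lemma block_normalizer_grows M D : engel_block M -> D `<=` X `&` M ->
  D `<=` normalizer D -> ~ X `&` M `<=` D ->
  exists u, [/\ X u, M u, ~ D u & normalizer D u].
Proof.
move=> [sgM hM _] DXM DD XMD; apply: contrapT => noU.
pose K := M `&` normalizer D.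
have sgK : subgroup K.
  have /subgroupP[M1 MD] := sgM.
  have /subgroupP[D1 DV] := subgroup_normalizer D.
  by apply/subgroupP; split=> // x y [Mx Dx] [My Dy]; split; auto.
have XKD : X `&` K = D.
  apply/seteqP; split=> [u [Xu [Mu Du]]|u Du].
    by apply: contrapT => nDu; apply: noU; exists u.
  by have [Xu Mu] := DXM _ Du; split=> //; split=> //; exact: DD.
have [h [Mh Kh Kh']] : exists h, [/\ M h, ~ K h & normalizer K h].
  apply: hypercentral_normalizer => //; first by move=> ? [].
  by move=> MK; apply: XMD; rewrite -XKD => x [Xx /MK].
apply: Kh; split=> //; rewrite -XKD.
by apply: normalizerP => x [Xx Kx]; split;
  [exact: X_conj|exact: normalizerJ|exact: X_conj|exact: normalizerJV].
Qed.

(** Choose u in M and v in M', both in X, outside D and normalizing D.  All the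
    commutators [v,_k u] normalize D, the first of them, v, does not normalize
    M (it would lie in M), and the last of them, 1, does.  For the last w among
    them that does not normalize M, the conjugate w u w^-1 = [w, u] u normalizes
    M, hence lies in M; it also lies in w M w^-1, and it is outside D as u is. *)
Lemma engel_block_zipper M M' D : maximal_block M -> maximal_block M' ->
  M <> M' -> D = X `&` (M `&` M') ->
  exists2 w, conj_set M w <> M & D `<` X `&` (M `&` conj_set M w).
Proof.
move=> mM mM' neqMM' defD.
have bM := mM.1; have bM' := mM'.1.
have incomparable P Q : maximal_block P -> maximal_block Q -> P <> Q ->
    ~ X `&` P `<=` Q.
  move=> [[sgP hP genP] maxP] [bQ maxQ] neqPQ XPQ; apply: neqPQ.
  have PQ : P `<=` Q.
    apply: subset_trans genP _; apply: smallest_sub => //.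
    by case: bQ.
  by apply/seteqP; split=> //; exact: maxP.
have DN : D `<=` normalizer D.
  move=> d; rewrite {1}defD => -[Xd [Md M'd]].
  have [[sgM _ _] [sgM' _ _]] := (bM, bM').
  have nMd := subgroup_sub_normalizer sgM Md.
  have nM'd := subgroup_sub_normalizer sgM' M'd.
  rewrite defD; apply: normalizerP => x [Xx [Mx M'x]]; split;
    try split; by [exact: X_conj|exact: normalizerJ|exact: normalizerJV].
have [|//||u [Xu Mu Du nDu]] := @block_normalizer_grows M D bM.
- by rewrite defD => x [Xx []].
- move=> XMD; apply: (incomparable M M') => // x /XMD.
  by rewrite defD => -[_ []].
have [|//||v [Xv M'v Dv nDv]] := @block_normalizer_grows M' D bM'.
- by rewrite defD => x [Xx []].
- move=> XMD; apply: (incomparable M' M) => //; first exact: nesym.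
  by move=> x /XMD; rewrite defD => -[_ []].
have nMv : ~ normalizer M v.
  move=> /(maximal_block_normalizer mM Xv) Mv; apply: Dv.
  by rewrite defD.
have sgND := subgroup_normalizer D.
have [|w [nDw nMw nMwu]] := engel_last_step (X_engel Xu) _
    (subgroup_one (subgroup_normalizer M)) nDv nMv.
  by move=> y nDy; exact: subgroup_comm.
exists w => //; split=> [d Dd|/(_ (u ^ w^-1)) uwD].
  have := normalizerJ nDw Dd; move: Dd; rewrite defD => -[Xd [Md _]] [_ [Mdw _]].
  by split.
apply: Du; rewrite -[u](conjgKV w); apply: normalizerJ => //; apply: uwD.
split; first exact: X_conj.
split; last by rewrite /conj_set /= conjgKV.
(* u ^ w^-1 = [w, u] u, and both factors normalize M. *)
apply: (maximal_block_normalizer mM); first exact: X_conj.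
rewrite -[u ^ _](mulgVK u) -commE.
apply: subgroup_mul => //; first exact: subgroup_normalizer.
by apply: subgroup_sub_normalizer => //; case: bM.
Qed.

(** For infinite X there are two different maximal blocks, and among such pairs
    one has a maximal meet with X, against [engel_block_zipper]. *)
Lemma finite_engel_blocks :
  (forall y, X y -> exists2 B, finite_set B &
     forall M, subgroup M -> hypercentral M -> M y -> M `<=` B) ->
  finite_set X.
Proof.
move=> X_bound; apply: contrapT => X_infinite.
have max_block y : X y -> exists2 M, maximal_block M & M y.
  move=> Xy; have [B Bfin yB] := X_bound y Xy.
  have b1y : engel_block (generated ([set 1] `|` [set y])).
    apply: engel_block_adjoin => //; first exact: engel_block1.
    by apply: normalizerP => _ ->; rewrite conj1g.
  have gy : generated ([set 1] `|` [set y]) y.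
    by apply: sub_gen_smallest; right.
  have [|M [bM /(_ y gy) My maxM]] := exists_maximal_set Bfin b1y.
    by move=> M [sgM hM _] /(_ y gy); exact: yB.
  by exists M.
pose meets D := exists M M',
  [/\ maximal_block M, maximal_block M', M <> M' & D = X `&` (M `&` M')].
have no_maximal_meet D : meets D ->
    ~ forall E, meets E -> D `<=` E -> E `<=` D.
  move=> [M [M' [mM mM' neqMM' defD]]] maxD.
  have [w neqw [DE ED]] := engel_block_zipper mM mM' neqMM' defD.
  apply: ED; apply: maxD DE.
  exists M, (conj_set M w); split=> //; first exact: maximal_block_conj.
  exact: nesym.
have [x Xx] := infinite_setN0 X_infinite.
have [M mM Mx] := max_block x Xx.
have [B Bfin xB] := X_bound x Xx.
have [y [Xy My]] : exists y, X y /\ ~ M y.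
  apply: contrapT => noy; apply: X_infinite; apply: sub_finite_set Bfin.
  move=> y Xy; case: mM => -[sgM hM _] _; apply: (xB M) => //.
  by apply: contrapT => My; apply: noy; exists y.
have [M' mM' M'y] := max_block y Xy.
have D0 : meets (X `&` (M `&` M')).
  by exists M, M'; split=> // eqMM'; apply: My; rewrite eqMM'.
(* A maximal meet exists: above a nonempty one all meets are confined to the
   finite set attached to one of its points; if all are empty, any will do. *)
have [[D [mD [z Dz]]]|noD] := pselect (exists D, meets D /\ D !=set0).
  have Xz : X z by case: mD => [P [Q [_ _ _ defD]]]; move: Dz; rewrite defD => -[].
  have [C Cfin zC] := X_bound z Xz.
  have [|E [mE _ maxE]] := exists_maximal_set Cfin mD.
    move=> _ [P [Q [[[sgP hP _] _] _ _ ->]]] /(_ z Dz) [_ [Pz _]].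
    by apply: subset_trans (zC P sgP hP Pz) => t [_ []].
  exact: no_maximal_meet mE maxE.
apply: (no_maximal_meet _ D0) => E mE _ t Et.
by exfalso; apply: noD; exists E; split=> //; exists t.
Qed.

End EngelBlocks.

(** * Infinite groups with finite center and finite proper centralizers *)

Section FiniteCentralizers.
Variable G : groupType.
Hypothesis G_infinite : infinite_set [set: G].
Hypothesis center_finite : finite_set (center G).
Hypothesis centralizer_finite :
  forall g : G, ~ center G g -> finite_set (centralizer g).
Implicit Types (x y z : G) (N : set G).

Lemma subgroup_center : subgroup (center G).
Proof.
apply/subgroupP; split=> [g|x y Zx Zy g]; first exact/commute_sym/commute1.
by apply/commute_sym/commuteM; [exact/commute_sym/Zx|exact/commuteV/commute_sym/Zy].
Qed.

Lemma normalizer_center g : normalizer (center G) g.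
Proof.
have ZJ h x : center G x -> x ^ h = x.
  by move=> Zx; rewrite conjgE Zx !gnorm.
by apply: normalizerP => x Zx; rewrite ZJ.
Qed.

(** The fibers of z |-> [z, y] are left cosets of the finite group C(y). *)
Lemma finite_comm_preimage y (B : set G) :
  ~ center G y -> finite_set B -> finite_set [set z | B (comm z y)].
Proof.
move=> Zy Bfin; apply: (@finite_preimage_fibers _ _ (fun z => comm z y) B) => // b _.
have [[z0 z0b]|nob] := pselect (exists z0, comm z0 y = b); last first.
  apply: (sub_finite_set (B := set0)) => // z zb.
  by exfalso; apply: nob; exists z.
apply: (sub_finite_set (B := [set z0 * c | c in centralizer y])).
  move=> z; rewrite /= -z0b => zz0; exists (z0^-1 * z); last exact: mulVKg.
  rewrite /centralizer /= /commute.
  move: zz0; rewrite /comm => /mulIg zz0.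
  by rewrite -mulgA -[z * y](mulgVK z) zz0 !gnorm.
exact/finite_image/centralizer_finite.
Qed.

(** The set X of noncentral Engel operators is finite by [finite_engel_blocks],
    although it contains all z x z^-1 = [z, x] x as soon as it contains x. *)
Lemma engel_operator_central x : engel_operator x -> center G x.
Proof.
move=> xE; apply: contrapT => Zx.
pose X : set G := [set y | ~ center G y /\ engel_operator y].
have XJ y g : X y -> X (y ^ g).
  move=> [Zy yE]; split; last exact: engel_operatorJ.
  by move=> /(normalizerJV (normalizer_center g)); rewrite conjgK.
have X_finite : finite_set X.
  apply: finite_engel_blocks => // [y [_ //]|y [Zy _]].
  (* M contains a noncentral z that is central in M modulo the center of G. *)
  exists (\bigcup_(z in [set z | center G (comm z y)] `\` center G)
            [set w | center G (comm w z)]).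
    apply: bigcup_finite => [|z [_ Zz]]; last exact: finite_comm_preimage.
    exact/finite_setD/finite_comm_preimage.
  move=> M sgM hM My k Mk.
  have [||z [Mz Zz zM]] := hM _ subgroup_center.
  - by move=> g _; exact: normalizer_center.
  - by move=> /(_ y My).
  exists z; first by split=> //; exact: zM.
  by rewrite /= -commV; exact: subgroup_inv subgroup_center (zM _ Mk).
apply: G_infinite.
apply: sub_finite_set (finite_comm_preimage Zx (finite_image (fun y => y / x) X_finite)).
by move=> z _ /=; exists (x ^ z^-1); [exact: XJ|rewrite commE].
Qed.

Lemma left_engel_central : left_engel_set G = center G.
Proof.
apply/seteqP; split=> x.
  by move=> /left_engel_set_operator; exact: engel_operator_central.
by move=> Zx g; exists 1%N; apply/comm_eq1.
Qed.

(** [g, x] lies in N since N is normal, and each further commutator with x goes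
    down one step in the lower central series of N. *)
Lemma nilpotent_normal_engel N x :
  normal_subgroup N -> nilpotent_subgroup N -> N x -> engel_operator x.
Proof.
move=> [sgN nN] [_ [n Nn1]] Nx g; exists n.+1.
suff : lower_central_series N n (iter_comm g n.+1 x) by rewrite Nn1.
elim: n {Nn1} => [|n IHn].
  rewrite /iter_comm /= commE; apply: subgroup_mul => //; first exact: nN.
  exact: subgroup_inv.
by apply: sub_gen_smallest; exists (iter_comm g n.+1 x) => //; exists x.
Qed.

Lemma fitting_center : fitting G = center G.
Proof.
apply/seteqP; split.
  apply: smallest_sub; first exact: subgroup_center.
  move=> x [N [nN nilN] Nx].
  exact/engel_operator_central/(nilpotent_normal_engel nN nilN).
move=> x Zx; apply: sub_gen_smallest; exists (center G) => //.
have sgZ := subgroup_center; split; first split=> //.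
  by move=> y g; exact: normalizerJ (normalizer_center g).
split=> //; exists 1%N.
apply/seteqP; split=> [|_ ->]; last exact: subgroup_one (subgroup_generated _).
apply: smallest_sub; first by apply/subgroupP; split=> // _ _ -> ->; rewrite divg1.
by move=> _ [y Zy [z _ <-]]; apply/comm_eq1.
Qed.

End FiniteCentralizers.

(** * The cofinite topology bounds centralizers *)

Section Cofinite.
Variable G : groupType.
Hypothesis G_nonabelian : ~ abelian_group G.
Hypothesis G_cofinite : Cprime_cofinite G.

Lemma Cprime_closed A : Cprime_closed_subbase G A -> closed (A : set (Cprime_space G)).
Proof.
move=> sbA; rewrite -[A]setCK; apply: open_closedC.
exists [set ~` A]; last by rewrite bigcup_set1.
move=> _ ->; exists [fset (~` A : set G)]%fset.
  by move=> U /fset1P ->; apply: mem_set; rewrite /= setCK.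
by rewrite set_fset1 bigcap_set1.
Qed.

Lemma cofinite_centralizer_finite (g : G) :
  ~ center G g -> finite_set (centralizer g).
Proof.
move=> Zg.
have : closed (centralizer g : set (Cprime_space G)).
  apply: Cprime_closed; right; exists 1, g; apply/seteqP; split=> x.
    by exists x => //; rewrite mul1g.
  by move=> [y gy <-]; rewrite mul1g.
move=> /(G_cofinite _) [gT|//]; exfalso; apply: Zg => h.
have : [set: G] h by []. 
by rewrite -gT => /commute_sym.
Qed.

Lemma cofinite_center_finite : finite_set (center G).
Proof.
have /existsNP [x /existsNP [y xy]] := G_nonabelian.
have /cofinite_centralizer_finite : ~ center G y.
  by move=> /(_ x) /commute_sym.
by apply: sub_finite_set => z /(_ y).
Qed.

End Cofinite.

Theorem theorem7p2 (G : groupType)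
    (G_infinite : infinite_set [set: G])
    (G_nonabelian : ~ abelian_group G)
    (G_cofinite : Cprime_cofinite G) :
  [/\ center G = left_engel_set G,
      left_engel_set G = fitting G
    & ~ engel_group G].
Proof.
have Zfin := cofinite_center_finite G_nonabelian G_cofinite.
have Cfin := cofinite_centralizer_finite G_cofinite.
have LZ := left_engel_central G_infinite Zfin Cfin.
split; rewrite ?LZ //.
  by rewrite (fitting_center G_infinite Zfin Cfin).
rewrite /engel_group LZ => GZ; apply: G_nonabelian => x.
by have : [set: G] x by []; rewrite GZ.
Qed.
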